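(* Let $n,k\in\mathbb N$ with $k\le n-4$, and let $d_1,d_2\in\mathbb N^+$ with $d_1+d_2=\binom n2-k$ and $d_2\le d_1$. Then for each $\nu\in\Pi_{d_2,k}$ there exists $D_\nu\in\mathfrak D_n$ such that $\Delta(D_\nu)$ has bi-degree $(d_1,d_2)$ and $\mathrm{LM}(\varphi(D_\nu))=\rho_\nu$.
   Context: $\mathbb N=\{0,1,\dots\}$. Points are ordered by $(a,b)<(a',b')$ iff $a+b<a'+b'$, or $a+b=a'+b'$ and $a<a'$; $|P|=a+b$ for $P=(a,b)$. $\mathfrak D_n$ is the set of $n$-tuples $(P_1<\dots<P_n)$ of points of $\mathbb N\times\mathbb N$ in increasing order; $\Delta(D)=\det[x_i^{a_j}y_i^{b_j}]_{1\le i,j\le n}$ where $P_j=(a_j,b_j)$, a bihomogeneous polynomial of bi-degree $(\sum a_j,\sum b_j)$. $\Pi_{b,k}$ is the set of partitions of $k$ into at most $b$ parts; $\rho_\nu=\prod_i\rho_{\nu_i}$ (with $\rho_\emptyset=1$). $\rho_i$ has weight $i$, $\rho_0=1$; $h(b,w)$ is the weight-$w$ part of $(1+\rho_1+\rho_2+\cdots)^b$ ($0$ for $w<0$; $(\cdots)^0=1$). For $D=(P_1,\dots,P_n)$, $P_i=(a_i,b_i)$, $k=\binom n2-\sum|P_i|$: $\varphi(D)=(-1)^k\det[h(b_i,j-1-|P_i|)]_{1\le i,j\le n}$, a polynomial in the $\rho_i$ all of whose monomials have weight $k$. Monomials of weight $k$ are ordered by: $\rho_\nu<\rho_\mu$ (with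 $\nu,\mu$ written as nondecreasing sequences) if for some $j$, $\nu_i=\mu_i$ for $i<j$ and $\nu_j<\mu_j$. For a nonzero polynomial $f$ homogeneous of weight $k$, $\mathrm{LM}(f)$ is the largest monomial occurring with nonzero coefficient; for a nonzero constant $c$ (weight $0$), $\mathrm{LM}(c)=1$. *)

(* Defs.v *)
From HB Require Import structures.
From mathcomp Require Export all_boot all_order all_algebra.
From mathcomp.multinomials Require Export mpoly.

Set Implicit Arguments.
Unset Strict Implicit.
Unset Printing Implicit Defensive.

Import GRing.Theory.
Local Open Scope ring_scope.

Definition point := (nat * nat)%type.

Definition psize (P : point) : nat := (P.1 + P.2)%N.

Definition point_lt (P Q : point) : bool :=
  (psize P < psize Q)%N || ((psize P == psize Q) && (P.1 < Q.1)%N).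

Definition in_frakD (n : nat) (D : n.-tuple point) : bool := sorted point_lt D.

(* In n + n variables, the first n are x_1, ..., x_n and the last n are
   y_1, ..., y_n. *)
Definition xvar (n : nat) (i : 'I_n) : {mpoly int[n + n]} := 'X_(lshift n i).
Definition yvar (n : nat) (i : 'I_n) : {mpoly int[n + n]} := 'X_(rshift n i).

Definition Delta (n : nat) (D : n.-tuple point) : {mpoly int[n + n]} :=
  \det (\matrix_(i < n, j < n)
          (xvar i ^+ (tnth D j).1 * yvar i ^+ (tnth D j).2)).

Definition has_bidegree (n : nat) (f : {mpoly int[n + n]}) (d1 d2 : nat) :
    Prop :=
  f != 0 /\
  forall m, m \in msupp f ->
    (\sum_(i < n) m (lshift n i))%N = d1 /\
    (\sum_(i < n) m (rshift n i))%N = d2.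

(* Partitions are nondecreasing sequences of positive integers; this is
   membership in Pi_{b,k}. *)
Definition is_partition (b k : nat) (nu : seq nat) : bool :=
  [&& sorted leq nu, all (fun p => (0 < p)%N) nu, sumn nu == k
    & (size nu <= b)%N].

(* rho_1, ..., rho_N are the N variables of {mpoly int[N]} (so rho_i is 'X_j
   with j = i - 1, whose weight in the sense of mnmwgt is i), and rho_0 = 1.
   For i > N the value is a dummy. *)
Definition rho (N i : nat) : {mpoly int[N]} :=
  if i is i'.+1 then
    if insub i' is Some j then 'X_(j : 'I_N) else 0
  else 1.

Definition rho_part (N : nat) (nu : seq nat) : {mpoly int[N]} :=
  \prod_(p <- nu) rho N p.

(* The variables of weight > N are dropped from the series, which does not
   affect its part of weight w when w <= N. *)
Definition h (N b : nat) (w : int) : {mpoly int[N]} :=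
  match w with
  | Posz w' => pihomog mnmwgt w' ((\sum_(i < N.+1) rho N i) ^+ b)
  | Negz _ => 0
  end.

(* The weights j - |P_i| are at most n - 1, so rho_1, ..., rho_n suffice.
   The column index j starts at 0. *)
Definition phi (n : nat) (D : n.-tuple point) : {mpoly int[n]} :=
  let k : int := 'C(n, 2)%:Z - (\sum_(i < n) psize (tnth D i))%N%:Z in
  (-1) ^+ `|k|%N *
  \det (\matrix_(i < n, j < n)
          h n (tnth D i).2 ((j : nat)%:Z - (psize (tnth D i))%:Z)).

(* The nondecreasing sequence nu with 'X_[m] = rho_nu. *)
Definition parts_of (N : nat) (m : 'X_{1..N}) : seq nat :=
  flatten [seq nseq (m i) i.+1 | i : 'I_N].

(* Used only between monomials of the same weight, where neither sequence is a
   proper prefix of the other. *)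
Definition mon_lt (N : nat) (m1 m2 : 'X_{1..N}) : Prop :=
  let nu := parts_of m1 in
  let mu := parts_of m2 in
  exists j : nat,
    [/\ (j < size nu)%N, (j < size mu)%N,
        forall i, (i < j)%N -> nth 0%N nu i = nth 0%N mu i
      & (nth 0%N nu j < nth 0%N mu j)%N].

(* g = LM(f); in particular f is nonzero. *)
Definition is_LM (N : nat) (f g : {mpoly int[N]}) : Prop :=
  exists m : 'X_{1..N},
    [/\ g = 'X_[m], m \in msupp f
      & forall m', m' \in msupp f -> m' = m \/ mon_lt m' m].

(* Main.v *)
(* Only the sizes |P_i| need to be fixed in order to prescribe LM(phi(D)): any
   choice of the ordinates b_i keeping the points distinct gives the same
   leading monomial, and the sum of the b_i takes every value between its
   extremes, so it can be made equal to d_2.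

   If the two rows of smallest size s are followed by no row of size s or
   s + w, put rho_i = 0 for i < w: the columns s and s + w then vanish outside
   these two rows, where they form a 2 x 2 determinant (b' - b) rho_w. Three
   rows of size s followed only by rows of size at least s + 3 split off a
   Vandermonde determinant, a nonzero multiple of rho_1^3. A unique row of
   smallest size splits off the factor 1. Peeling off the parts of nu in
   increasing order gives LM(phi(D)) = rho_nu.

   A single part w takes w + 1 rows, which is one too many, but two consecutive
   parts 2 <= w_1 <= w_2 fit in w_2 + 2 <= w_1 + w_2 rows and three parts 1 fit
   in three. Hence only up to two parts 1 and one larger part cost an
   additional row, which together with the rows needed at the bottom of the
   quadrant accounts for k <= n - 4. *)
From HB Require Import structures.
From mathcomp Require Import fingroup perm zify ring.
Require Import Defs.

Set Implicit Arguments.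
Unset Strict Implicit.
Unset Printing Implicit Defensive.

Import GRing.Theory Num.Theory.

(** * Shapes *)

(* [shape S C nu]: rows of sizes [S], paired with the columns [C] in the order
   in which they are split off, produce the parts [nu]. *)
Inductive shape : seq nat -> seq nat -> seq nat -> Prop :=
| shape_nil : shape [::] [::] [::]
| shape_one s S C nu : shape S C nu -> all (ltn s) S ->
    shape (s :: S) (s :: C) nu
| shape_two s w S C nu : shape S C nu -> (0 < s) -> (0 < w) ->
    all (fun t => (s < t) && (t != s + w)) S -> all (leq w) nu ->
    shape [:: s, s & S] [:: s, (s + w) & C] (w :: nu)
| shape_three s S C nu : shape S C nu -> (1 < s) -> all (leq (s + 3)) S ->
    shape [:: s, s, s & S] [:: s, s.+1, s.+2 & C] [:: 1, 1, 1 & nu].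

Lemma shape_size S C nu : shape S C nu -> size C = size S.
Proof. by elim=> //= *; lia. Qed.

(** In each block the columns exceed the row sizes by exactly the parts produced: by 0, by w, or by
    0 + 1 + 2 for three parts 1. *)
Lemma shape_sumn S C nu : shape S C nu -> sumn C = sumn S + sumn nu.
Proof. by elim=> //= *; lia. Qed.

(** This keeps the interval of sums in [shape_points] nonempty, so that the tail of a shape can
    always be assigned some sum. *)
Lemma shape_double_size S C nu : shape S C nu -> (size nu).*2 <= sumn S.
Proof. by elim=> //= *; lia. Qed.

Lemma path_point_lt P L :
  all (ltn (psize P)) (map psize L) -> sorted point_lt L -> path point_lt P L.
Proof.
by case: L => //= Q L /andP[PQ _] ->; rewrite andbT /point_lt; move: PQ => /= ->.
Qed.

Lemma point_lt_level s b b' : b' < b <= s -> point_lt (s - b, b) (s - b', b').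
Proof. by rewrite /point_lt /psize /=; lia. Qed.

Lemma psize_level s b : b <= s -> psize (s - b, b) = s.
Proof. by rewrite /psize /=; lia. Qed.

(** One, two or three rows of size s with distinct ordinates attain every sum in [0, s], [1, 2s - 1]
    or [3, 3s - 3] respectively, and these intervals add up to the stated one. Within a size,
    decreasing ordinates give increasing points. *)
Lemma shape_points S C nu : shape S C nu ->
  forall t, size nu <= t -> t + size nu <= sumn S ->
  exists L, [/\ map psize L = S, sorted point_lt L & sumn (map snd L) = t].
Proof.
elim=> {S C nu} [|s S C nu sh IH sS|s w S C nu sh IH s0 w0 sS wnu
  |s S C nu sh IH s1 sS] t /= t1 t2.
- by exists [::]; split=> //=; lia.
(* In all three cases the tail receives as much of t as its upper bound permits, after the minimum
   0, 1 or 3 of the first block is set aside. *)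
- have d := shape_double_size sh; case: (IH (minn t (sumn S - size nu)));
    [lia|lia|] => L [eS sL sbL].
  pose b := t - minn t (sumn S - size nu); have bs : b <= s by lia.
  exists ((s - b, b) :: L); rewrite /= psize_level // eS; split=> //; last lia.
  by apply: path_point_lt => //; rewrite psize_level ?eS.
- have d := shape_double_size sh; case: (IH (minn t.-1 (sumn S - size nu)));
    [lia|lia|] => L [eS sL sbL].
  have [b [b' [bb bs sb]]] : exists b b', [/\ b' < b, b <= s
      & b + b' = t - minn t.-1 (sumn S - size nu)].
    set u := t - _; case: (leqP u s) => us; first by exists u, 0; split; lia.
    by exists s, (u - s); split; lia.
  exists [:: (s - b, b), (s - b', b') & L].
  rewrite /= !psize_level ?eS ?point_lt_level /=; try lia; split=> //; last lia.
  apply: path_point_lt => //; rewrite psize_level ?eS; last lia.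
  by apply: sub_all sS => x /andP[].
have d := shape_double_size sh; case: (IH (minn (t - 3) (sumn S - size nu)));
  [lia|lia|] => L [eS sL sbL].
have [b [b' [b'' [bb bb' bs sb]]]] : exists b b' b'', [/\ b' < b, b'' < b', b <= s
    & b + (b' + b'') = t - minn (t - 3) (sumn S - size nu)].
  set u := t - _; case: (leqP u s.+1) => us; first by exists u.-1, 1, 0; split; lia.
  case: (leqP u (s + s.-1)) => us'; first by exists s, (u - s), 0; split; lia.
  by exists s, s.-1, (u - (s + s.-1)); split; lia.
exists [:: (s - b, b), (s - b', b'), (s - b'', b'') & L].
rewrite /= !psize_level ?eS ?point_lt_level /=; try lia; split=> //; last lia.
apply: path_point_lt => //; rewrite psize_level ?eS; last lia.
by apply: sub_all sS => x /=; lia.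
Qed.

(** * Packing the parts of a partition into n columns *)

Lemma shape_iota a m S C nu : shape S C nu -> all (leq (a + m)) S ->
  shape (iota a m ++ S) (iota a m ++ C) nu.
Proof.
move=> sh; elim: m a => //= m IH a aS; constructor.
  by apply: IH; rewrite addSnnS.
rewrite all_cat; apply/andP; split; last by apply: sub_all aS => x /=; lia.
by apply/allP => x; rewrite mem_iota /=; lia.
Qed.

(** The state of the construction once the columns below t are used up: the remaining columns t,
    ..., n - 1 have to be filled exactly, by rows of size at least t. *)
Definition fits (t n : nat) (nu : seq nat) : Prop := exists S C,
  [/\ shape S C nu, all (leq t) S & perm_eq C (iota t (n - t))].

Lemma fits_iota t m n nu : t + m <= n -> fits (t + m) n nu -> fits t n nu.
Proof.
move=> tn [S [C [sh aS pC]]]; exists (iota t m ++ S), (iota t m ++ C); split.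
- exact: shape_iota.
- rewrite all_cat; apply/andP; split; last by apply: sub_all aS => x /=; lia.
  by apply/allP => x; rewrite mem_iota /=; lia.
- have -> : n - t = m + (n - (t + m)) by lia.
  by rewrite iotaD perm_cat2l.
Qed.

Lemma fits_nil t n : t <= n -> fits t n [::].
Proof.
move=> tn; apply: (@fits_iota _ (n - t)); first lia.
exists [::], [::]; split=> //; first exact: shape_nil.
by rewrite subnKC // subnn.
Qed.

(** The part takes the columns t and t + w, and single rows fill the columns strictly between them,
    so no row has size t + w. *)
Lemma fits_single t n w nu : 0 < t -> 0 < w -> all (leq w) nu ->
  t + w.+1 <= n -> fits (t + w.+1) n nu -> fits t n (w :: nu).
Proof.
move=> t0 w0 wnu tn [S [C [sh aS pC]]].
exists [:: t, t & iota t.+1 w.-1 ++ S], [:: t, t + w & iota t.+1 w.-1 ++ C].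
split.
- apply: shape_two => //; last first.
    rewrite all_cat; apply/andP; split; last by apply: sub_all aS => x /=; lia.
    by apply/allP => x; rewrite mem_iota /=; lia.
  by apply: shape_iota => //; apply: sub_all aS => x /=; lia.
- rewrite /= leqnn /= all_cat; apply/andP; split; last by apply: sub_all aS => x /=; lia.
  by apply/allP => x; rewrite mem_iota /=; lia.
- have -> : n - t = (w.-1 + (1 + (n - (t + w.+1)))).+1 by lia.
  rewrite /= iotaD perm_cons -cat1s perm_catCA perm_cat2l.
  rewrite (_ : t.+1 + w.-1 = t + w) /=; last lia.
  by rewrite perm_cons (_ : (t + w).+1 = t + w.+1) // addnS.
Qed.

Lemma fits_triple t n nu : 1 < t -> t + 3 <= n -> fits (t + 3) n nu ->
  fits t n [:: 1, 1, 1 & nu].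
Proof.
move=> t1 tn [S [C [sh aS pC]]].
exists [:: t, t, t & S], [:: t, t.+1, t.+2 & C]; split.
- exact: shape_three.
- by rewrite /= leqnn /=; apply: sub_all aS => x /=; lia.
- have -> : n - t = (n - (t + 3)).+3 by lia.
  by rewrite /= !perm_cons (_ : t.+3 = t + 3) // addn3.
Qed.

(** Two interleaved blocks: rows t, t with columns t, t + w1, and rows t + 1, t + 1 with columns t +
    1, t + 1 + w2. Single rows [I] and [J] fill the gaps on both sides of t + w1. If w1 were 1, the
    second block would have the forbidden size t + w1. *)
Lemma fits_pair t n w1 w2 nu : 0 < t -> 1 < w1 <= w2 -> all (leq w2) nu ->
  t + w2.+2 <= n -> fits (t + w2.+2) n nu -> fits t n [:: w1, w2 & nu].
Proof.
move=> t0 w12 wnu tn [S [C [sh aS pC]]].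
pose I := iota t.+2 (w1 - 2); pose J := iota (t + w1).+1 (w2 - w1).
have allIJS (p : pred nat) :
    (forall x, t + 2 <= x -> x != t + w1 -> x != t.+1 + w2 -> p x) ->
    all p (I ++ J ++ S).
  move=> hp; rewrite !all_cat; apply/and3P; split; apply/allP => x.
  - by rewrite mem_iota => ?; apply: hp; lia.
  - by rewrite mem_iota => ?; apply: hp; lia.
  - by move/(allP aS) => /= ?; apply: hp; lia.
exists [:: t, t, t.+1, t.+1 & I ++ J ++ S],
       [:: t, t + w1, t.+1, t.+1 + w2 & I ++ J ++ C]; split.
- apply: shape_two => //.
  + apply: shape_two => //; [|lia|]; last by apply: allIJS => x; lia.
    apply: shape_iota; last first.
      rewrite all_cat; apply/andP; split; last by apply: sub_all aS => x /=; lia.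
      by apply/allP => x; rewrite mem_iota; lia.
    by apply: shape_iota => //; apply: sub_all aS => x /=; lia.
  + lia.
  + by rewrite /= allIJS => [|x]; lia.
  + by rewrite /=; apply/andP; split; [lia | apply: sub_all wnu => x /=; lia].
- by rewrite /= leqnn leqnSn /=; apply: allIJS => x; lia.
- have -> : n - t =
      1 + (1 + ((w1 - 2) + (1 + ((w2 - w1) + (1 + (n - (t + w2.+2))))))) by lia.
  rewrite !iotaD /= -/I.
  rewrite (_ : t + 1 + 1 + (w1 - 2) = t + w1); last lia.
  rewrite (_ : t + w1 + 1 + (w2 - w1) = t.+1 + w2); last lia.
  rewrite (_ : t.+1 + w2 + 1 = t + w2.+2); last lia.
  rewrite !addn1 -/I -/J; apply/seq.permP => p.
  rewrite /= !count_cat /= !count_cat /= (seq.permP pC p). ring.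
Qed.

(** Parts are consumed two at a time, at no more columns than their sum; the strict inequality
    provides the extra column for a last unpaired part. *)
Lemma fits_ge2 nu t n : sorted leq nu -> all (leq 2) nu -> 0 < t ->
  t + sumn nu < n -> fits t n nu.
Proof.
elim: {nu}(size nu).+1 {-2}nu (ltnSn (size nu)) t => // l IH.
case=> [|w1 [|w2 nu]] /= sz t srt wnu t0 tn.
- by apply: fits_nil; lia.
- by apply: fits_single => //; [lia|lia|apply: fits_nil; lia].
- case/andP: srt => w12 srt; case/and3P: wnu => w1ge w2ge wnu.
  have w2nu : all (leq w2) nu by apply: order_path_min srt; apply: leq_trans.
  apply: fits_pair => //; [lia|lia|]; apply: IH => //;
    [lia|exact: path_sorted srt|lia|lia].
Qed.

Lemma fits_triples q nu t n : sorted leq nu -> all (leq 2) nu -> 1 < t ->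
  t + 3 * q + sumn nu < n -> fits t n (nseq (3 * q) 1 ++ nu).
Proof.
move=> srt wnu; elim: q t => [|q IH] t t1 tn.
  by rewrite muln0 /=; apply: fits_ge2 => //; lia.
rewrite (_ : 3 * q.+1 = (3 * q).+3); last lia.
by apply: fits_triple => //; [lia|apply: IH; lia].
Qed.

Lemma partition_ones nu : sorted leq nu -> all (leq 1) nu ->
  exists a nu', [/\ nu = nseq a 1 ++ nu', sorted leq nu' & all (leq 2) nu'].
Proof.
elim: nu => [|w nu IH] /=; first by exists 0, [::].
move=> srt /andP[w0 wnu]; have [w1|w1] := eqVneq w 1.
  have [a [nu' [e s' a']]] := IH (path_sorted srt) wnu.
  by exists a.+1, nu'; rewrite /= -e w1.
exists 0, (w :: nu); split=> //=; apply/andP; split; first lia.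
have := order_path_min leq_trans srt; apply: sub_all => x /=; lia.
Qed.

(** Let r be the number of parts 1 modulo 3. Triples need sizes above 1, so for r = 0 they start at
    level 2. Otherwise the r surplus ones start at level 1 and take two columns each, and the
    triples start at level 3 or 5. The case r = 2 needs 5 + (k - 2) < n, which is k + 4 <= n. *)
Lemma fits_partition n nu : sorted leq nu -> all (leq 1) nu ->
  sumn nu + 4 <= n -> fits 0 n nu.
Proof.
move=> srt nu1; have [a [nu' [-> s' a']]] := partition_ones srt nu1.
have a1 : all (leq 1) nu' by apply: sub_all a' => x /=; lia.
have r3 : a %% 3 < 3 by rewrite ltn_mod.
rewrite sumn_cat sumn_nseq mul1n (divn_eq a 3) (mulnC _ 3).
move: (a %/ 3) (a %% 3) r3 => q r r3 kn; rewrite addnC nseqD -catA.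
have ones1 : all (leq 1) (nseq (3 * q) 1 ++ nu') by rewrite all_cat all_nseq a1 orbT.
case: r r3 kn => [|[|[|//]]] _ kn.
- by apply: (@fits_iota _ 2); [lia|apply: fits_triples => //; lia].
- apply: (@fits_iota _ 1); first lia.
  by apply: fits_single => //; [lia|apply: fits_triples => //; lia].
- apply: (@fits_iota _ 1); first lia.
  apply: fits_single => //; first lia.
  by apply: fits_single => //; [lia|apply: fits_triples => //; lia].
Qed.

Local Open Scope ring_scope.

(** * Leading monomials *)

Section LeadingMonomial.
Variable N : nat.
Implicit Types (f g p q : {mpoly int[N]}) (m : 'X_{1..N}).

(* For monomials of the same weight this is [mon_lt], see [mult_lt_mon_lt]; in
   this form the order is visibly compatible with products. *)
Definition mult_lt m' m : Prop :=
  exists2 i : 'I_N, forall j : 'I_N, (j < i)%N -> m' j = m j & (m i < m' i)%N.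

Definition lead f m : Prop :=
  f@_m != 0 /\ forall m', f@_m' != 0 -> m' = m \/ mult_lt m' m.

Lemma mult_ltDl u m' m : mult_lt m' m -> mult_lt (u + m')%MM (u + m)%MM.
Proof.
case=> i eqm ltm; exists i => [j ltji|]; first by rewrite !mnmDE eqm.
by rewrite !mnmDE ltn_add2l.
Qed.

(** Multiplication by a term translates the support, and [mult_lt] is invariant under
    translation. *)
Lemma lead_mulX c u g m :
  c != 0 -> lead g m -> lead (c *: 'X_[u] * g) (u + m)%MM.
Proof.
move=> c0 [gm gle].
have co m' : (c *: 'X_[u] * g)@_(u + m') = c * g@_m'.
  by rewrite -scalerAl mcoeffZ mulrC ['X_[u] * g]mulrC mcoeffMX mulrC.
split=> [|m']; first by rewrite co mulf_neq0.
rewrite -scalerAl mcoeffZ => /eqP ne0.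
have: m' \in msupp (g * 'X_[u]).
  rewrite mcoeff_msupp; apply: contra_notN ne0 => /eqP h0.
  by rewrite mulrC ['X_[u] * g]mulrC h0 mul0r.
rewrite (perm_mem (msuppMX _ _)) => /mapP[m'' hm'' ->].
rewrite mcoeff_msupp in hm''.
case: (gle _ hm'') => [->|/(mult_ltDl u)]; [by left | by right].
Qed.

Lemma lead_sign (e : nat) f m : lead f m -> lead ((-1) ^+ e * f) m.
Proof.
have -> : (-1) ^+ e * f = (-1) ^+ e *: 'X_[0%MM] * f.
  congr (_ * _); rewrite mpolyX0 -signr_odd -[in RHS]signr_odd.
  by case: (odd e); rewrite ?expr0 ?expr1 ?scale1r ?scaleN1r.
by move=> lf; rewrite -[m]add0m; apply: lead_mulX; rewrite ?signr_eq0.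
Qed.

Definition small (w : nat) m := [exists i : 'I_N, (i.+1 < w)%N && (0 < m i)%N].

Lemma smallP w m :
  reflect (exists i : 'I_N, (i.+1 < w)%N && (0 < m i)%N) (small w m).
Proof. exact: existsP. Qed.

(* The substitution rho_i = 0 for i < w; it kills the monomials with a part less
   than w, all of which are smaller than those without such a part. *)
Definition kappa (w : nat) f : {mpoly int[N]} :=
  f \mPo [tuple if (i.+1 < w)%N then 0 else 'X_i | i < N].

HB.instance Definition _ w := GRing.RMorphism.copy (kappa w)
  (comp_mpoly [tuple if (i.+1 < w)%N then 0 else 'X_i | i < N]).

Lemma kappaX w m : kappa w 'X_[m] = if small w m then 0 else 'X_[m].
Proof.
rewrite /kappa comp_mpolyX; case: (boolP (small w m)) => [/smallP[i /andP[iw mi]]|nsm].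
  by rewrite (bigD1 i) //= tnth_mktuple iw expr0n gtn_eqF ?mul0r.
rewrite [RHS]mpolyXE_id; apply: eq_bigr => i _; rewrite tnth_mktuple.
case: ifP => // iw; case: (posnP (m i)) => [->|mi]; first by rewrite !expr0.
by move/negP: nsm; case; apply/smallP; exists i; rewrite iw.
Qed.

Lemma mcoeff_kappa w f m : (kappa w f)@_m = if small w m then 0 else f@_m.
Proof.
rewrite /kappa comp_mpolyEX raddf_sum /=.
under eq_bigr => m' _ do rewrite -/(kappa w _) kappaX mcoeffZ.
rewrite [in RHS](mpolyE f) raddf_sum /=.
case: ifP => sm.
  rewrite big1 // => m' _; case: ifP => [_|nsm]; rewrite ?mcoeff0 ?mulr0 //.
  rewrite mcoeffX; case: eqP => [eqm|_]; last by rewrite mulr0.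
  by rewrite -eqm nsm in sm.
apply: eq_bigr => m' _; rewrite mcoeffZ; case: ifP => // sm'.
rewrite mcoeff0 mcoeffX; case: eqP => [eqm|_]; last by rewrite mulr0.
by rewrite -eqm sm' in sm.
Qed.

(** The least variable occurring in m' is the first at which the exponents differ, since m has no
    part below w. *)
Lemma small_mult_lt w m' m : small w m' -> ~~ small w m -> mult_lt m' m.
Proof.
move=> /smallP [i0 Hi0] nsm.
case: (arg_minnP (P := fun i : 'I_N => (i.+1 < w)%N && (0 < m' i)%N) val Hi0).
move=> i /andP[iw mi] imin.
have mz (j : 'I_N) : (j.+1 < w)%N -> m j = 0%N.
  by move=> jw; apply/eqP; rewrite -leqn0 leqNgt; apply: contra nsm => mj;
     apply/smallP; exists j; rewrite jw.
exists i => [j ji|]; last by rewrite mz.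
have jw : (j.+1 < w)%N by lia.
rewrite mz //; apply/eqP; rewrite -leqn0 leqNgt; apply/negP => mj.
by have := imin j; rewrite jw mj => /(_ isT) /=; lia.
Qed.

Lemma lead_kappa w f m : ~~ small w m -> lead (kappa w f) m <-> lead f m.
Proof.
move=> nsm; rewrite /lead mcoeff_kappa (negPf nsm); split=> -[f0 fle];
  split=> // m' fm'; case: (boolP (small w m')) => sm'.
- by right; apply: small_mult_lt nsm.
- by apply: fle; rewrite mcoeff_kappa (negPf sm').
- by rewrite mcoeff_kappa sm' eqxx in fm'.
- by apply: fle; rewrite mcoeff_kappa (negPf sm') in fm'.
Qed.

(** * Parts of low weight of the powers of 1 + rho_1 + rho_2 + .. *)

Lemma mnmwgt_eq0 m : mnmwgt m = 0%N -> m = 0%MM.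
Proof.
move=> /eqP; rewrite /mnmwgt sum_nat_eq0 => /forallP/= h0.
by apply/mnmP => i; rewrite mnm0E; have := h0 i; rewrite muln_eq0 orbF => /eqP.
Qed.

Lemma mnm_peel m : (0 < mnmwgt m)%N -> exists i m', m = (U_(i) + m')%MM.
Proof.
move=> m0; have /existsP[i mi] : [exists i, (0 < m i)%N].
  apply: contraLR m0 => /existsPn h0; rewrite -leqNgt leqn0 sum_nat_eq0.
  by apply/forallP => i; rewrite muln_eq0 -leqn0 leqNgt h0.
exists i, (m - U_(i))%MM; rewrite addmC submK //.
by apply/mnm_lepP => j; rewrite mnm1E; case: eqP => // <-.
Qed.

Notation rhosum := (\sum_(i < N.+1) rho N i : {mpoly int[N]}).

Lemma rhosumE : rhosum = 1 + \sum_(i < N) 'X_i.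
Proof.
rewrite big_ord_recl /=; congr (_ + _); apply: eq_bigr => i _.
rewrite /rho /= add0n; case: insubP => [j _ ej|]; last by rewrite ltn_ord.
by have -> : j = i by apply: val_inj.
Qed.

(** The coefficients of degree one and two are read off from derivatives, which avoids a multinomial
    expansion. *)
Lemma mderiv_rhosumX b i : (rhosum ^+ b)^`M(i) = rhosum ^+ b.-1 *+ b.
Proof.
have d1 : rhosum^`M(i) = 1.
  rewrite rhosumE mderivD -mpolyC1 mderivC add0r raddf_sum /= (bigD1 i) //=.
  have UU : (U_(i) - U_(i) = 0)%MM by apply/mnmP => j; rewrite mnmBE subnn mnm0E.
  rewrite mderivX mnm1E eqxx scale1r UU mpolyX0 big1 ?addr0 ?mpolyC1 //.
  by move=> j ji; rewrite mderivX mnm1E (negPf ji) scale0r.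
elim: b => [|b IH]; first by rewrite expr0 -mpolyC1 mderivC mulr0n.
rewrite exprS mderivM d1 IH mul1r; case: b {IH} => [|b] /=.
  by rewrite mulr0n mulr0 addr0.
by rewrite mulrnAr -exprS -mulrS.
Qed.

Lemma rhosumX0 b : (rhosum ^+ b)@_0%MM = 1.
Proof.
rewrite rmorphXn /= rhosumE mcoeffD mcoeff1 eqxx raddf_sum /=.
rewrite big1 ?addr0 ?expr1n // => i _.
by rewrite mcoeffX mnm1_eq0.
Qed.

Lemma rhosumX1 b i : (rhosum ^+ b)@_(U_(i)) = b%:R.
Proof.
have := mcoeff_deriv i 0%MM (rhosum ^+ b).
by rewrite add0m mnm0E mulr1n mderiv_rhosumX mcoeffMn rhosumX0 => <-.
Qed.

(** The coefficient is binom(b, 2); the doubled form avoids division. *)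
Lemma rhosumX2 b i : (rhosum ^+ b)@_(U_(i) + U_(i))%MM *+ 2 = (b * b.-1)%:R.
Proof.
have := mcoeff_deriv i U_(i)%MM (rhosum ^+ b).
rewrite mnm1E eqxx => <-; rewrite mderiv_rhosumX mcoeffMn rhosumX1.
by rewrite -mulrnA mulnC.
Qed.

Lemma mcoeff_h b (u : nat) m :
  (h N b u)@_m = if mnmwgt m == u then (rhosum ^+ b)@_m else 0.
Proof.
rewrite /h pihomogE raddf_sum /=; set p := _ ^+ b.
have coE m' : (p@_m' *: 'X_[m'])@_m = p@_m' * (m' == m)%:R.
  by rewrite mcoeffZ mcoeffX.
under eq_bigr do rewrite coE.
case: ifP => wm.
  rewrite [in RHS](mpolyE p) raddf_sum /= big_mkcond /=; apply: eq_bigr => m' _.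
  rewrite coE; case: ifP => // wm'; case: eqP => [eqm|_]; last by rewrite mulr0.
  by rewrite eqm wm in wm'.
rewrite big1 // => m' wm'; case: eqP => [eqm|_]; last by rewrite mulr0.
by rewrite -eqm wm' in wm.
Qed.

Lemma h_weight0 b : h N b 0%N = 1.
Proof.
apply/mpolyP => m; rewrite mcoeff_h mcoeff1; case: eqP => [/mnmwgt_eq0 ->|].
  by rewrite rhosumX0 eqxx.
by case: eqP => // -> []; rewrite mnmwgt0.
Qed.

Lemma kappa_h_lt w b u : (0 < u < w)%N -> kappa w (h N b u) = 0.
Proof.
move=> uw; apply/mpolyP => m; rewrite mcoeff_kappa mcoeff_h mcoeff0.
case: (boolP (small w m)) => // nsm; case: eqP => // wm; case/negP: nsm.
have [|i [m' em]] := @mnm_peel m; first lia.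
apply/smallP; exists i; rewrite em mnmDE mnm1E eqxx.
by move: wm; rewrite em mnmwgtD mnmwgt1; lia.
Qed.

(** Among the monomials of weight i + 1, only the single variable of that weight has no smaller
    part. *)
Lemma kappa_h_eq (i : 'I_N) b : kappa i.+1 (h N b i.+1) = b%:R *: 'X_i.
Proof.
apply/mpolyP => m; rewrite mcoeff_kappa mcoeff_h mcoeffZ mcoeffX.
case: ifP => [sm|nsm].
  case: eqP => [em|_]; last by rewrite mulr0.
  case/smallP: sm => j; rewrite -em mnm1E.
  by case: eqP => [<-|]; lia.
case: eqP => wm.
  have [|j [m' em]] := @mnm_peel m; first lia.
  have ij : (i <= j)%N.
    rewrite leqNgt; apply: contraFN nsm => ji; apply/smallP; exists j.
    by rewrite em mnmDE mnm1E eqxx; lia.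
  move: wm; rewrite em mnmwgtD mnmwgt1 => wm.
  have /mnmwgt_eq0 -> : mnmwgt m' = 0%N by lia.
  have -> : j = i by apply: val_inj => /=; lia.
  by rewrite addm0 rhosumX1 eqxx mulr1.
case: eqP => [em|_]; last by rewrite mulr0.
by case: wm; rewrite -em mnmwgt1.
Qed.

Lemma h_weight1 (i : 'I_N) b : i = 0%N :> nat -> h N b 1%N = b%:R *: 'X_i.
Proof.
(* No part is smaller than 1, so [kappa 1] is the identity. *)
move=> i0; have := kappa_h_eq i b; rewrite i0 => <-; apply/mpolyP => m.
rewrite mcoeff_kappa; case: ifP => // /smallP[j]; lia.
Qed.

Lemma h_weight2 (i j : 'I_N) b : i = 0%N :> nat -> j = 1%N :> nat ->
  h N b 2%N = b%:R *: 'X_j + (rhosum ^+ b)@_(U_(i) + U_(i))%MM *: 'X_i ^+ 2.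
Proof.
move=> i0 j1; have ij : (i == j) = false by apply/eqP => e; rewrite e in i0; lia.
apply/mpolyP => m; rewrite mcoeff_h mcoeffD !mcoeffZ expr2 -mpolyXD !mcoeffX.
case: eqP => wm.
  have [|k [m' em]] := @mnm_peel m; first lia.
  move: wm; rewrite em mnmwgtD mnmwgt1 => wm.
  have [k0|k1] : (k = 0 :> nat \/ k = 1 :> nat)%N by lia.
    have [|l [m'' em']] := @mnm_peel m'; first lia.
    move: wm; rewrite em' mnmwgtD mnmwgt1 => wm.
    have /mnmwgt_eq0 -> : mnmwgt m'' = 0%N by lia.
    have -> : k = i by apply: val_inj => /=; lia.
    have -> : l = i by apply: val_inj => /=; lia.
    rewrite addm0 eqxx mulr1; case: eqP => [e|_]; last by rewrite mulr0 add0r.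
    by have /mnmP/(_ j) := e; rewrite mnmDE !mnm1E ij eqxx.
  have /mnmwgt_eq0 -> : mnmwgt m' = 0%N by lia.
  have -> : k = j by apply: val_inj => /=; lia.
  rewrite addm0 rhosumX1 eqxx mulr1; case: eqP => [e|_]; last by rewrite mulr0 addr0.
  by have /mnmP/(_ j) := e; rewrite mnmDE !mnm1E ij eqxx.
case: eqP => [em|_]; first by case: wm; rewrite -em mnmwgt1 j1.
case: eqP => [em|_]; first by case: wm; rewrite -em mnmwgtD mnmwgt1 i0.
by rewrite !mulr0 addr0.
Qed.

End LeadingMonomial.

(** * Determinants of shapes *)

Lemma det_mx22 (R : comNzRingType) (A : 'M[R]_2) :
  \det A = A ord0 ord0 * A ord_max ord_max - A ord0 ord_max * A ord_max ord0.
Proof.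
rewrite (expand_det_row _ ord0) !big_ord_recl big_ord0 /cofactor !det_mx11 !mxE.
rewrite /= addr0 expr0 expr1 mul1r mulN1r mulrN.
by congr (_ * A _ _ - A _ _ * A _ _); apply: val_inj.
Qed.

Section SeqDeterminant.
Variables (A B : eqType) (R : comNzRingType) (a0 : A) (b0 : B).
Implicit Types (F : A -> B -> R) (r : seq A) (c : seq B).

(** With rows and columns listed by sequences, splitting off a block is concatenation, and the
    columns may come in any order. *)
Definition seqmx F (n : nat) r c : 'M[R]_n :=
  \matrix_(i < n, j < n) F (nth a0 r i) (nth b0 c j).

Definition seqdet F r c : R := \det (seqmx F (size r) r c).

(** The matrix is block upper triangular. *)
Lemma seqdet_cat F r1 r2 c1 c2 :
    size c1 = size r1 -> {in r2 & c1, forall x y, F x y = 0} ->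
  seqdet F (r1 ++ r2) (c1 ++ c2) = seqdet F r1 c1 * seqdet F r2 c2.
Proof.
move=> sz F0; rewrite /seqdet size_cat.
rewrite -[seqmx F (_ + _) _ _]submxK.
have -> : dlsubmx (seqmx F (size r1 + size r2) (r1 ++ r2) (c1 ++ c2)) = 0.
  apply/matrixP => i j; rewrite !mxE /= !nth_cat sz ltn_ord ltnNge leq_addr /= addKn.
  by rewrite F0 ?mem_nth ?sz.
rewrite det_ublock; congr (_ * _); congr (\det _); apply/matrixP => i j;
  rewrite !mxE /= !nth_cat sz ?ltn_ord //.
by rewrite !ltnNge !leq_addr /= !addKn.
Qed.

Lemma seqdet1 F x y : seqdet F [:: x] [:: y] = F x y.
Proof. by rewrite /seqdet /= det_mx11 !mxE. Qed.

Lemma seqdet2 F x x' y y' :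
  seqdet F [:: x; x'] [:: y; y'] = F x y * F x' y' - F x y' * F x' y.
Proof. by rewrite /seqdet /= det_mx22 !mxE. Qed.

Lemma seqdet3 F x x' x'' y y' y'' :
  seqdet F [:: x; x'; x''] [:: y; y'; y''] =
    F x y * (F x' y' * F x'' y'' - F x' y'' * F x'' y')
  - F x y' * (F x' y * F x'' y'' - F x' y'' * F x'' y)
  + F x y'' * (F x' y * F x'' y' - F x' y' * F x'' y).
Proof.
rewrite /seqdet /= (expand_det_row _ ord0) !big_ord_recl big_ord0 /cofactor.
rewrite !det_mx22 !mxE /=; ring.
Qed.

Lemma rmorph_seqdet (phi : {rmorphism R -> R}) F r c :
  phi (seqdet F r c) = seqdet (fun x y => phi (F x y)) r c.
Proof.
by rewrite /seqdet -det_map_mx; congr (\det _); apply/matrixP => i j; rewrite !mxE.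
Qed.

End SeqDeterminant.

(** * Splitting off the blocks of a shape *)

Definition part_mnm (N : nat) (nu : seq nat) : 'X_{1..N} :=
  [multinom count_mem i.+1 nu | i < N].

Section ShapeLead.
Variable N : nat.

Definition hentry (P : point) (c : nat) : {mpoly int[N]} :=
  h N P.2 (c%:Z - (psize P)%:Z).

Lemma hentry_lt P c : (c < psize P)%N -> hentry P c = 0.
Proof.
by move=> ltc; rewrite /hentry (_ : _ - _ = Negz (psize P - c).-1) //; lia.
Qed.

Lemma hentryD P s u : psize P = s -> hentry P (s + u) = h N P.2 u.
Proof. by move=> sP; rewrite /hentry sP; congr h; lia. Qed.

Lemma hentry_eq P s : psize P = s -> hentry P s = 1.
Proof. by move=> /(hentryD 0); rewrite addn0 h_weight0. Qed.

Lemma part_mnm_cons (i : 'I_N) nu :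
  part_mnm N (i.+1 :: nu) = (U_(i) + part_mnm N nu)%MM.
Proof. by apply/mnmP => j; rewrite mnmDE mnm1E !mnmE /= eqSS. Qed.

Lemma part_mnm_nsmall w nu : all (leq w) nu -> ~~ small w (part_mnm N nu).
Proof.
move=> /allP wnu; apply/smallP => -[i]; rewrite mnmE -has_count has_pred1.
by case/andP=> iw /wnu /=; lia.
Qed.

Lemma point_ltP P Q : point_lt P Q -> psize P = psize Q -> (Q.2 < P.2)%N.
Proof. by rewrite /point_lt /psize; lia. Qed.

Lemma seqdet2_lead (i : 'I_N) P Q :
    psize P = psize Q ->
  kappa i.+1 (seqdet (0, 0)%N 0%N hentry [:: P; Q] [:: psize P; (psize P + i.+1)%N])
  = (Q.2%:R - P.2%:R) *: 'X_i.
Proof.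
move=> PQ; rewrite seqdet2 !(hentryD _ (erefl (psize P))) !(hentryD _ (esym PQ)).
rewrite !hentry_eq // mul1r mulr1 raddfB /= !kappa_h_eq.
by rewrite scalerBl.
Qed.

(** A row is 1, b rho_1, b rho_2 + binom(b, 2) rho_1^2. The rho_2 terms are proportional to the
    second column and cancel; what remains is rho_1^3 times half the Vandermonde determinant of the
    ordinates. *)
Lemma seqdet3_lead (i j : 'I_N) P Q T :
    i = 0%N :> nat -> j = 1%N :> nat ->
    psize P = psize Q -> psize P = psize T -> uniq [:: P.2; Q.2; T.2] ->
  exists2 c : int, c != 0 &
    seqdet (0, 0)%N 0%N hentry [:: P; Q; T] [:: psize P; (psize P).+1; (psize P).+2]
    = c *: 'X_[U_(i) + (U_(i) + U_(i))].
Proof.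
move=> i0 j1 PQ PT dis.
pose x (R : point) := ((\sum_(i < N.+1) rho N i) ^+ R.2)@_(U_(i) + U_(i))%MM.
pose b (R : point) : int := R.2%:R.
have x2 R : x R *+ 2 = b R * (b R - 1).
  by rewrite /x rhosumX2 /b; case: (R.2) => [|n] //=; lia.
exists ((b Q - b P) * (x T - x P) - (b T - b P) * (x Q - x P)).
  apply/eqP => c0; have : (b Q - b P) * (b T - b P) * (b T - b Q) = 0.
    (* Doubling turns each x into b (b - 1), and the linear terms drop out. *)
    transitivity (((b Q - b P) * (x T - x P) - (b T - b P) * (x Q - x P)) *+ 2).
      rewrite mulrnBl -!mulrnAr !mulrnBl !x2; ring.
    by rewrite c0 mul0rn.
  move/eqP; rewrite !mulf_eq0 !subr_eq0 /b !eqr_nat.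
  by move: dis; rewrite /= !inE; lia.
have e1 R : psize P = psize R -> hentry R (psize P).+1 = (b R)%:MP * 'X_i.
  by move=> e; rewrite -addn1 (hentryD _ (esym e)) (h_weight1 _ i0) mul_mpolyC.
have e2 R : psize P = psize R ->
    hentry R (psize P).+2 = (b R)%:MP * 'X_j + (x R)%:MP * 'X_i ^+ 2.
  by move=> e; rewrite -addn2 (hentryD _ (esym e)) (h_weight2 _ i0 j1) !mul_mpolyC.
rewrite seqdet3 !e1 // !e2 // !hentry_eq // -mul_mpolyC !mpolyXD.
rewrite mpolyCB !mpolyCM !mpolyCB; ring.
Qed.

Lemma shape_lead S C nu : (1 < N)%N -> shape S C nu -> all (leq^~ N) nu ->
  forall L, map psize L = S -> sorted point_lt L ->
  lead (seqdet (0, 0)%N 0%N hentry L C) (part_mnm N nu).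
Proof.
move=> N1; elim=> {S C nu}
  [|s S C nu _ IH sS|s w S C nu _ IH s0 w0 sS wnu|s S C nu _ IH s1 sS] nuN.
- case=> // _ _; rewrite /seqdet det_mx00.
  have -> : part_mnm N [::] = 0%MM by apply/mnmP => i; rewrite !mnmE.
  split=> [|m]; rewrite mcoeff1 ?eqxx //.
  by case: (eqVneq m 0%MM) => [->|]; [left | rewrite eqxx].
- case=> // P L [sP eS] srt; rewrite -cat1s -[s :: C]cat1s seqdet_cat //.
    rewrite seqdet1 hentry_eq // mul1r; apply: IH => //.
    exact: path_sorted srt.
  move=> Q c QL; rewrite inE => /eqP ->; apply: hentry_lt.
  by have /allP := sS; apply; rewrite -eS map_f.
- case=> // P [|Q L] //= [sP sQ eS] /andP[PQ srt].
  case/andP: nuN => wN nuN.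
  case: w w0 sS wnu wN => // w _ sS wnu wN; pose i := Ordinal wN.
  rewrite -[P :: _]/([:: P; Q] ++ L) -[s :: _]/([:: s; (s + w.+1)%N] ++ C).
  have dQP := point_ltP PQ; rewrite sP sQ in dQP.
  (* The block splits off only after [kappa]. As all remaining parts are at least as large, [kappa]
     is removed again from the other factor before the induction hypothesis is used. *)
  rewrite -[w.+1]/(i.+1); apply/(lead_kappa (w := i.+1)).
    by apply: part_mnm_nsmall; rewrite /= leqnn.
  rewrite rmorph_seqdet seqdet_cat //.
    rewrite -!(rmorph_seqdet _ _ (@kappa N i.+1))/=.
    have := seqdet2_lead i (etrans sP (esym sQ)); rewrite sP => ->.
    rewrite (part_mnm_cons i nu); apply: lead_mulX; first by rewrite subr_eq0 eqr_nat; lia.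
    apply/lead_kappa; first exact: part_mnm_nsmall.
    by apply: IH => //; apply: path_sorted srt.
  move=> R c RL; have /allP/(_ (psize R)) := sS.
  rewrite -eS map_f // => /(_ isT) /andP[sR sRw].
  rewrite !inE => /orP[] /eqP ->; first by rewrite hentry_lt ?raddf0.
  (* A size above the column gives a negative weight. A size strictly between the two columns leaves
     a positive weight below the part, which [kappa] kills. *)
  case: (ltnP (s + w.+1) (psize R)) => cR; first by rewrite hentry_lt ?raddf0.
  have -> : (s + w.+1 = psize R + (s + w.+1 - psize R))%N by lia.
  rewrite hentryD // /= kappa_h_lt //; lia.
case=> // P [|Q [|T L]] //= [sP sQ sT eS] /and3P[PQ QT srt].
have [dPQ dQT] := (point_ltP PQ, point_ltP QT).
rewrite sP sQ sT in dPQ dQT; have {}dPQ := dPQ erefl; have {}dQT := dQT erefl.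
pose i := Ordinal (ltnW N1); pose j := Ordinal N1.
rewrite -[P :: _]/([:: P; Q; T] ++ L) -[s :: _]/([:: s; s.+1; s.+2] ++ C).
rewrite seqdet_cat //.
  have dis : uniq [:: P.2; Q.2; T.2] by rewrite /= !inE; lia.
  have [//|//|//|||c c0] := @seqdet3_lead i j P Q T; rewrite ?sP ?sQ ?sT // => ->.
  have e nu' : part_mnm N (1%N :: nu') = (U_(i) + part_mnm N nu')%MM.
    exact: (part_mnm_cons i).
  rewrite (_ : part_mnm _ _ = U_(i) + (U_(i) + U_(i)) + part_mnm N nu)%MM;
    last by rewrite !e !addmA.
  apply: lead_mulX => //; apply: IH => //.
    by case/and4P: nuN.
  exact: path_sorted srt.
move=> R c RL; have /allP/(_ (psize R)) := sS.
rewrite -eS map_f // => /(_ isT) sR cs; apply: hentry_lt.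
by move: cs; rewrite !inE; lia.
Qed.

End ShapeLead.

(** * Bidegree and homogeneity *)

Lemma point_lt_irr : irreflexive point_lt.
Proof. by move=> P; rewrite /point_lt !ltnn andbF. Qed.

Lemma point_lt_trans : transitive point_lt.
Proof. by move=> Q P R; rewrite /point_lt; lia. Qed.

Section Bidegree.
Variables (n : nat) (D : n.-tuple point).

Definition perm_mnm (s : 'S_n) : 'X_{1..n + n} :=
  [multinom match split i with
            | inl j => (tnth D (s j)).1
            | inr j => (tnth D (s j)).2
            end | i < n + n].

Lemma perm_mnml s i : perm_mnm s (lshift n i) = (tnth D (s i)).1.
Proof. by rewrite mnmE (unsplitK (inl i)). Qed.

Lemma perm_mnmr s i : perm_mnm s (rshift n i) = (tnth D (s i)).2.
Proof. by rewrite mnmE (unsplitK (inr i)). Qed.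

Lemma DeltaE : Delta D = \sum_(s : 'S_n) (-1) ^+ s *: 'X_[perm_mnm s].
Proof.
apply: eq_bigr => s _.
have -> : \prod_(i < n) 
    (\matrix_(i0, j) (xvar i0 ^+ (tnth D j).1 * yvar i0 ^+ (tnth D j).2)) i (s i)
  = 'X_[perm_mnm s].
  rewrite [RHS]mpolyXE_id big_split_ord /= -big_split /=.
  by apply: eq_bigr => i _; rewrite mxE perm_mnml perm_mnmr.
by case: (odd_perm s); rewrite ?expr0 ?expr1 ?mulN1r ?mul1r ?scale1r ?scaleN1r.
Qed.

(** The points are distinct, so different permutations give different monomials and nothing cancels
    in the Leibniz expansion. *)
Lemma Delta_bidegree : in_frakD D ->
  has_bidegree (Delta D) (\sum_(i < n) (tnth D i).1)%N (\sum_(i < n) (tnth D i).2)%N.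
Proof.
move=> srt.
have uD : uniq D := sorted_uniq point_lt_trans point_lt_irr srt.
have inj s s' : perm_mnm s = perm_mnm s' -> s = s'.
  move=> e; apply/perm.permP => i; apply: (tuple_uniqP D uD).
  have := congr1 (fun m : 'X_{1..n + n} => m (lshift n i)) e.
  have := congr1 (fun m : 'X_{1..n + n} => m (rshift n i)) e.
  rewrite !perm_mnml !perm_mnmr.
  by case: (tnth D (s i)) (tnth D (s' i)) => [a b] [a' b'] /= -> ->.
split.
  apply/eqP => D0; have := congr1 (mcoeff (perm_mnm 1)) D0.
  rewrite DeltaE mcoeff0 raddf_sum /= (bigD1 1%g) //= big1 => [|s s1].
    by rewrite mcoeffZ mcoeffX eqxx odd_perm1 addr0.
  rewrite mcoeffZ mcoeffX; case: eqP => [/inj e|_]; last by rewrite mulr0.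
  by rewrite e eqxx in s1.
move=> m; rewrite DeltaE => /msupp_sum_le /flattenP[c /mapP[s _ ->]].
move=> /msuppZ_le; rewrite msuppX inE => /eqP ->; split.
  under eq_bigr do rewrite perm_mnml.
  by rewrite [RHS](reindex_inj (@perm_inj _ s)).
under eq_bigr do rewrite perm_mnmr.
by rewrite [RHS](reindex_inj (@perm_inj _ s)).
Qed.

End Bidegree.

Section Homogeneity.
Variable N : nat.

Lemma dhomog_bigprod (I : finType) (F : I -> {mpoly int[N]}) (d : I -> nat) :
  (forall i, F i \is (d i).-homog for mnmwgt) ->
  \prod_i F i \is (\sum_i d i).-homog for mnmwgt.
Proof.
move=> hF; elim/big_rec2: _ => [|i d' p _ hp]; first exact: dhomog1.
exact: dhomogM.
Qed.

Lemma hentry_homog P c : hentry N P c \is (c - psize P).-homog for mnmwgt.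
Proof.
case: (ltnP c (psize P)) => cP; first by rewrite hentry_lt ?dhomog0.
by rewrite -{1}(subnKC cP) hentryD //; apply: pihomogP.
Qed.

(** Homogeneity allows the passage from [mult_lt] to [mon_lt]. Truncated subtraction is harmless: a
    Leibniz term either contains an entry of negative weight and vanishes, or all its differences
    are exact. *)
Lemma phi_homog (D : N.-tuple point) : exists d, phi D \is d.-homog for mnmwgt.
Proof.
exists (\sum_(i < N) i - \sum_(i < N) psize (tnth D i))%N.
rewrite /phi -signr_odd; set p := \det _.
suff hp : p \is (\sum_(i < N) i - \sum_(i < N) psize (tnth D i))%N.-homog for mnmwgt.
  by case: (odd _); rewrite ?expr0 ?expr1 ?mul1r ?mulN1r ?dhomogN.
apply: rpred_sum => s _; rewrite -signr_odd.
suff ht : \prod_(i < N) hentry N (tnth D i) (s i) \is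
    (\sum_(i < N) i - \sum_(i < N) psize (tnth D i))%N.-homog for mnmwgt.
  under eq_bigr do rewrite mxE.
  by case: (odd _); rewrite ?expr0 ?expr1 ?mul1r ?mulN1r ?dhomogN.
have [/forallP ge|/forallPn[i]] := boolP [forall i, psize (tnth D i) <= s i]%N; last first.
  by rewrite -ltnNge => lti; rewrite (bigD1 i) //= hentry_lt // mul0r dhomog0.
rewrite [X in (X - _)%N](reindex_inj (@perm_inj _ s)) -sumnB //.
by apply: dhomog_bigprod => i; apply: hentry_homog.
Qed.

End Homogeneity.

(** * Comparison of the two monomial orders *)

Section MonomialOrder.
Variable N : nat.
Implicit Types m : 'X_{1..N}.

Lemma parts_ofE m :
  parts_of m = flatten [seq nseq (m i) i.+1 | i <- enum 'I_N].
Proof. by []. Qed.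

Lemma sumn_parts_of m : sumn (parts_of m) = mnmwgt m.
Proof.
rewrite parts_ofE sumn_flatten -map_comp sumnE big_map big_enum /=.
by apply: eq_bigr => i _; rewrite sumn_nseq mulnC.
Qed.

Lemma parts_of_split m (i : 'I_N) : exists2 r, all (ltn i.+1) r &
  parts_of m = flatten [seq nseq (m j) j.+1 | j <- take i (enum 'I_N)]
               ++ nseq (m i) i.+1 ++ r.
Proof.
exists (flatten [seq nseq (m j) j.+1 | j <- drop i.+1 (enum 'I_N)]).
  apply/allP => x /flattenP[_ /mapP[j jd ->]] /nseqP[-> _] /=.
  have : val j \in drop i.+1 (map val (enum 'I_N)) by rewrite -map_drop map_f.
  by rewrite val_enum_ord drop_iota mem_iota /=; lia.
rewrite parts_ofE -{1}(cat_take_drop i (enum 'I_N)).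
by rewrite (drop_nth i) ?size_enum_ord // nth_ord_enum map_cat flatten_cat.
Qed.

Lemma mult_lt_mon_lt m' m :
  mnmwgt m' = mnmwgt m -> mult_lt m' m -> mon_lt m' m.
Proof.
move=> ew [i eqm ltm]; rewrite /mon_lt.
move: (sumn_parts_of m) (sumn_parts_of m').
have [r ar ->] := parts_of_split m i; have [r' _ ->] := parts_of_split m' i.
have -> : [seq nseq (m' j) j.+1 | j <- take i (enum 'I_N)]
        = [seq nseq (m j) j.+1 | j <- take i (enum 'I_N)].
  apply/eq_in_map => j jt; rewrite eqm //.
  have : val j \in take i (map val (enum 'I_N)) by rewrite -map_take map_f.
  by rewrite val_enum_ord take_iota mem_iota /=; lia.
set pre := flatten _; rewrite !sumn_cat !sumn_nseq => wm wm'.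
(* If m had no part above i + 1, it would weigh less than m'. So after the common prefix and [m i]
   copies of i + 1, m continues with a larger part while m' still has i + 1. *)
case: r ar wm => [_ wm|x r /andP[/= ix _] _]; first by move: wm => /=; nia.
exists (size pre + m i)%N; rewrite !size_cat !size_nseq; split=> /=; try lia.
  move=> j; rewrite !nth_cat !size_nseq !nth_nseq => jl.
  by case: ltnP => // pj; rewrite !ifT //; lia.
have e : (size pre + m i < size pre)%N = false by lia.
by rewrite !nth_cat e addKn !size_nseq ltm ltnn subnn /= nth_nseq ltm.
Qed.

End MonomialOrder.

(** * Construction of the tuple for a given partition *)

Lemma rho_partE N nu : all (leq 1) nu -> all (leq^~ N) nu ->
  rho_part N nu = 'X_[part_mnm N nu].
Proof.
rewrite /rho_part; elim: nu => [|[//|w] nu IH] /=.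
  move=> _ _; rewrite big_nil.
  have -> : part_mnm N [::] = 0%MM by apply/mnmP => i; rewrite !mnmE.
  by rewrite mpolyX0.
move=> nu1 /andP[wN nuN]; rewrite big_cons IH // (part_mnm_cons (Ordinal wN)).
by rewrite mpolyXD; congr (_ * _); rewrite /rho insubT.
Qed.

(** Listing the columns in the order of a shape only changes the sign. *)
Lemma phi_seqdet n (D : n.-tuple point) (c : seq nat) : perm_eq c (iota 0 n) ->
  exists e : nat, phi D = (-1) ^+ e * seqdet (0, 0)%N 0%N (@hentry n) D c.
Proof.
move=> pc; have szc : size c == n by rewrite (perm_size pc) size_iota.
pose ct := Tuple szc.
have /tuple_permP[s es] : perm_eq ct (map val (ord_tuple n)).
  by rewrite /= val_enum_ord.
rewrite /phi /=; set k := `|_|%N; set M := \matrix_(i, j) _.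
suff -> : seqdet (0, 0)%N 0%N (@hentry n) D c = (-1) ^+ s * \det M.
  exists (k + s)%N.
  by rewrite exprD -mulrA [(-1) ^+ s * (_ * _)]mulrA -expr2 sqrr_sign mul1r.
rewrite /seqdet size_tuple.
have -> : seqmx (0, 0)%N 0%N (@hentry n) n D c = col_perm s M.
  apply/matrixP => i j; rewrite !mxE -tnth_nth; congr hentry.
  have -> : nth 0%N c j = tnth ct j by rewrite (tnth_nth 0%N).
  rewrite (tnth_nth 0%N) es (nth_map j) ?size_enum_ord // tnth_map tnth_ord_tuple.
  by rewrite nth_ord_enum.
by rewrite col_permE det_mulmx det_perm odd_permV mulrC.
Qed.

Theorem theorem5p4 (n k d1 d2 : nat)
    (hk : (k + 4 <= n)%N)
    (hd1 : (0 < d1)%N) (hd2 : (0 < d2)%N)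
    (hd : (d1 + d2)%N = ('C(n, 2) - k)%N)
    (hd21 : (d2 <= d1)%N) :
  forall nu : seq nat, is_partition d2 k nu ->
    exists D : n.-tuple point,
      [/\ in_frakD D,
          has_bidegree (Delta D) d1 d2
        & is_LM (phi D) (rho_part n nu)].
Proof.
move=> nu /and4P[srt pos /eqP sk szd2].
have nuk : all (leq^~ n) nu.
  apply/allP => x xnu; suff : (x <= sumn nu)%N by lia.
  by rewrite (perm_sumn (perm_to_rem xnu)) /= leq_addr.
have [|S [C [sh _ pC]]] := @fits_partition n nu srt pos; first by rewrite sk.
rewrite subn0 in pC.
have sS : sumn S = (d1 + d2)%N.
  have sC : sumn C = 'C(n, 2).
    by rewrite (perm_sumn pC) sumnE -triangular_sum /index_iota subn0.
  by have := shape_sumn sh; rewrite hd -sC sk; lia.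
(* The upper bound on d2 amounts to [size nu <= d1], which follows from [size nu <= d2 <= d1]. *)
have [|L [eS sL sb]] := shape_points sh szd2; first by rewrite sS; lia.
have szL : size L == n.
  by rewrite -(size_map psize) eS -(shape_size sh) (perm_size pC) size_iota.
pose D := Tuple szL; exists D.
have sumD (f : point -> nat) : (\sum_(i < n) f (tnth D i))%N = sumn (map f L).
  by rewrite sumnE big_map -[L]/(tval D) big_tuple.
have b2 : (\sum_(i < n) (tnth D i).2)%N = d2 by rewrite sumD.
have b1 : (\sum_(i < n) (tnth D i).1)%N = d1.
  have : (\sum_(i < n) psize (tnth D i))%N = (d1 + d2)%N by rewrite sumD eS.
  by rewrite big_split /= b2; lia.
split; first exact: sL.
  by rewrite -b1 -b2; apply: Delta_bidegree.
have [e phiE] := phi_seqdet D pC.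
have [f0 fle] : lead (phi D) (part_mnm n nu).
  by rewrite phiE; apply: lead_sign; apply: (shape_lead _ sh) => //; lia.
have [d hom] := phi_homog D.
exists (part_mnm n nu); rewrite rho_partE // mcoeff_msupp; split=> // m' m'in.
have [|->|lt] := fle m'; [by rewrite -mcoeff_msupp | by left | right].
apply: mult_lt_mon_lt => //.
by rewrite (dhomog_mf hom m'in) (dhomog_mf hom) // mcoeff_msupp.
Qed.
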